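(* Let $\Gamma$ be a discrete group, $G$ an abelian standard Borel group and $\pi\colon\Gamma\to G$ a homomorphism. Let $\Lambda$ be a discrete group, and let $(\Sigma,m)$ be a $(\Gamma,\Lambda)$-coupling. Set $\Omega=\Sigma\times_\Lambda\Sigma$. Suppose that (1) the action $\Lambda\curvearrowright\Sigma/\Gamma$ is weakly mixing; and (2) there is an almost $(\Gamma\times\Gamma)$-equivariant Borel map from $\Omega$ into $(G,\pi,\pi)$. Then there exist a homomorphism $\rho\colon\Lambda\to G$ and an almost $(\Gamma\times\Lambda)$-equivariant Borel map $\Phi\colon\Sigma\to(G,\pi,\rho)$.
   Context: All discrete groups are countable. For discrete groups $\Gamma,\Lambda$, a $(\Gamma,\Lambda)$-coupling is a standard Borel space $(\Sigma,m)$ with a $\sigma$-finite positive measure and a measure-preserving action of $\Gamma\times\Lambda$ such that there exist Borel subsets $X,Y\subset\Sigma$ with $m(X)<\infty$, $m(Y)<\infty$ and $\Sigma=\bigsqcup_{\gamma\in\Gamma}(\gamma,e)Y=\bigsqcup_{\lambda\in\Lambda}(e,\lambda)X$ up to $m$-null sets. The quotients $\Sigma/\Gamma$ and $\Sigma/\Lambda$ are identified with the fundamental domains $Y$ and $X$, so carry finite measures, and $\Lambda$ (resp. $\Gamma$) acts on $\Sigma/\Gamma$ (resp. $\Sigma/\Lambda$) preserving the measure. $\Sigma\times_\Lambda\Sigma$ is the quotient of $\Sigma\times\Sigma$ by the diagonal action of $\Lambda$; it is a $(\Gamma,\Gamma)$-coupling, where $(\gamma_1,\gamma_2)\in\Gamma\times\Gamma$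 acts by $[x,y]\mapsto[\gamma_1x,\gamma_2y]$. Given a standard Borel group $G$ and homomorphisms $\pi\colon\Gamma\to G$, $\rho\colon\Lambda\to G$, $(G,\pi,\rho)$ denotes the Borel space $G$ with the action of $\Gamma\times\Lambda$ given by $(\gamma,\lambda)g=\pi(\gamma)g\rho(\lambda)^{-1}$. A Borel map $\Phi\colon\Sigma\to S$ from a coupling into a standard Borel space $S$ on which $\Gamma\times\Lambda$ acts is almost $(\Gamma\times\Lambda)$-equivariant if $\Phi((\gamma,\lambda)x)=(\gamma,\lambda)\Phi(x)$ for all $\gamma\in\Gamma$, $\lambda\in\Lambda$ and a.e. $x\in\Sigma$. A measure-preserving action of a discrete group on a probability space $(Y,\nu)$ (or finite measure space, after normalizing) is weakly mixing if the diagonal action on $(Y\times Y,\nu\times\nu)$ is ergodic. *)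

(* Defs.v *)
From HB Require Import structures.
From mathcomp Require Import all_boot all_order all_algebra.
From mathcomp Require Import all_classical all_reals all_analysis.

Set Implicit Arguments.
Unset Strict Implicit.
Unset Printing Implicit Defensive.

Import Order.TTheory GRing.Theory Num.Theory.

Local Open Scope classical_set_scope.
Local Open Scope ring_scope.
Local Open Scope group_scope.

(* A Hausdorff complete pseudometric space is a complete metric space, so P is
   Polish and f identifies the measurable sets of T with its Borel sets. *)
Definition standard_borel (R : realType) d (T : measurableType d) : Prop :=
  exists (P : completePseudoMetricType R) (f : T -> P),
    [/\ hausdorff_space P,
        exists2 D : set P, countable D & dense D,
        bijective f &
        forall A : set T, measurable A <-> <<s [set U : set P | open U] >> (f @` A)].

HB.mixin Record isBorelGroup (d : measure_display) G
    of Measurable d G & Group G := {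
  measurable_mulg : measurable_fun [set: G * G] (fun xy : G * G => xy.1 * xy.2) ;
  measurable_invg : measurable_fun [set: G] (fun x : G => x^-1)
}.

#[short(type="borelGroupType")]
HB.structure Definition BorelGroup d :=
  {G of Measurable d G & Group G & isBorelGroup d G}.

Record borel_action (H : groupType) d (T : measurableType d) := BorelAction {
  act_fun :> H -> T -> T ;
  act1 : forall x, act_fun 1 x = x ;
  actM : forall g h x, act_fun (g * h) x = act_fun g (act_fun h x) ;
  measurable_act : forall h, measurable_fun [set: T] (act_fun h)
}.

Fact orbit_display : measure_display -> measure_display.
Proof. by []. Qed.

Section derived_actions.
Context (H K : groupType) d (T : measurableType d) d' (S : measurableType d').

Program Definition act_left (a : borel_action (H * K)%type T) :
    borel_action H T := BorelAction (act_fun := fun h => a (h, 1)) _ _ _.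
Next Obligation. by move=> a x; exact: (act1 a). Qed.
Next Obligation.
move=> a g h x /=; rewrite -(actM a (g, 1) (h, 1)).
by congr (a (_, _) x); rewrite mulg1.
Qed.
Next Obligation. by move=> a h; exact: measurable_act. Qed.

Program Definition act_right (a : borel_action (H * K)%type T) :
    borel_action K T := BorelAction (act_fun := fun k => a (1, k)) _ _ _.
Next Obligation. by move=> a x; exact: (act1 a). Qed.
Next Obligation.
move=> a g h x /=; rewrite -(actM a (1, g) (1, h)).
by congr (a (_, _) x); rewrite mulg1.
Qed.
Next Obligation. by move=> a h; exact: measurable_act. Qed.

Lemma act_left_right (a : borel_action (H * K)%type T) h k x :
  act_left a h (act_right a k x) = act_right a k (act_left a h x).
Proof.
rewrite /= -(actM a (h, 1) (1, k)) -(actM a (1, k) (h, 1)).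
by congr (a (_, _) x); rewrite /= ?mulg1 ?mul1g.
Qed.

Program Definition act_prod (a : borel_action H T) (b : borel_action K S) :
    borel_action (H * K)%type (T * S)%type :=
  BorelAction (act_fun := fun hk xy => (a hk.1 xy.1, b hk.2 xy.2)) _ _ _.
Next Obligation. by move=> a b [x y] /=; rewrite !act1. Qed.
Next Obligation. by move=> a b g h [x y] /=; rewrite !actM. Qed.
Next Obligation.
move=> a b h; apply: measurable_fun_pair => /=.
- exact: measurableT_comp (measurable_act a h.1) measurable_fst.
- exact: measurableT_comp (measurable_act b h.2) measurable_snd.
Qed.

Program Definition act_diag (a : borel_action H T) :
    borel_action H (T * T)%type :=
  BorelAction (act_fun := fun h xy => (a h xy.1, a h xy.2)) _ _ _.
Next Obligation. by move=> a [x y] /=; rewrite !act1. Qed.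
Next Obligation. by move=> a g h [x y] /=; rewrite !actM. Qed.
Next Obligation.
move=> a h; apply: measurable_fun_pair => /=.
- exact: measurableT_comp (measurable_act a h) measurable_fst.
- exact: measurableT_comp (measurable_act a h) measurable_snd.
Qed.

End derived_actions.

Definition actions_commute (H K : groupType) d (T : measurableType d)
    (a : borel_action H T) (b : borel_action K T) : Prop :=
  forall h k x, a h (b k x) = b k (a h x).

Section orbit_space.
Context (H : groupType) d (T : measurableType d) (a : borel_action H T).

Definition action_orbit (x : T) : set T := [set a h x | h in [set: H]].

Definition orbit_space : Type := {O : set T | exists x, O = action_orbit x}.

Definition orbit_class (x : T) : orbit_space :=
  exist _ (action_orbit x) (ex_intro _ x erefl).

HB.instance Definition _ := gen_eqMixin orbit_space.
HB.instance Definition _ := gen_choiceMixin orbit_space.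
HB.instance Definition _ := isPointed.Build orbit_space (orbit_class point).

Definition orbit_measurable : set (set orbit_space) :=
  image_set_system [set: T] orbit_class measurable.

Let orbit_sigma_algebra : sigma_algebra [set: orbit_space] orbit_measurable.
Proof. exact/sigma_algebra_image/sigma_algebra_measurable. Qed.

Let orbit_measurable0 : orbit_measurable set0.
Proof. by case: orbit_sigma_algebra. Qed.

Let orbit_measurableC A : orbit_measurable A -> orbit_measurable (~` A).
Proof. by case: orbit_sigma_algebra => _ + _ => /[apply]; rewrite setTD. Qed.

Let orbit_measurableU (F : (set orbit_space)^nat) :
  (forall i, orbit_measurable (F i)) -> orbit_measurable (\bigcup_i F i).
Proof. by case: orbit_sigma_algebra => _ _; apply. Qed.

HB.instance Definition _ := @isMeasurable.Build (orbit_display d) orbit_space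
  orbit_measurable orbit_measurable0 orbit_measurableC orbit_measurableU.

Lemma measurable_orbit_class : measurable_fun [set: T] orbit_class.
Proof. by move=> _ A mA; exact: mA. Qed.

Lemma orbit_class_act h x : orbit_class (a h x) = orbit_class x.
Proof.
apply: eq_exist; apply/seteqP; split=> [_ [g _ <-]|_ [g _ <-]].
- by exists (g * h) => //; rewrite actM.
- by exists (g / h) => //; rewrite -actM divgK.
Qed.

Definition orbit_repr (O : orbit_space) : T := sval (cid (svalP O)).

Lemma orbit_reprK O : orbit_class (orbit_repr O) = O.
Proof.
by case: O => O hO; apply: eq_exist; rewrite /orbit_repr; case: cid => /= x ->.
Qed.

Lemma orbit_repr_class x : exists h, orbit_repr (orbit_class x) = a h x.
Proof.
have [] : action_orbit x (orbit_repr (orbit_class x)).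
  have /(congr1 sval)/= <- := orbit_reprK (orbit_class x).
  by exists 1 => //; rewrite act1.
by move=> h _ <-; exists h.
Qed.

End orbit_space.

Section quotient_action.
Context (H K : groupType) d (T : measurableType d).
Context (a : borel_action H T) (b : borel_action K T).
Hypothesis ab : actions_commute a b.

Definition quot_act_fun (k : K) (O : orbit_space a) : orbit_space a :=
  orbit_class a (b k (orbit_repr O)).

Lemma quot_act_class k x :
  quot_act_fun k (orbit_class a x) = orbit_class a (b k x).
Proof.
by rewrite /quot_act_fun; have [h ->] := orbit_repr_class a x;
   rewrite -ab orbit_class_act.
Qed.

Program Definition quot_act : borel_action K (orbit_space a) :=
  BorelAction (act_fun := quot_act_fun) _ _ _.
Next Obligation. by move=> O; rewrite /quot_act_fun act1 orbit_reprK. Qed.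
Next Obligation.
move=> g h O; rewrite -(orbit_reprK O) !quot_act_class.
by rewrite actM.
Qed.
Next Obligation.
move=> k _ A mA; rewrite setTI; move: mA; rewrite /measurable/=.
rewrite /orbit_measurable /image_set_system /= !setTI => mA.
rewrite [X in measurable X](_ : _ = b k @^-1` (orbit_class a @^-1` A)).
  by rewrite -[X in measurable X]setTI; exact: measurable_act.
by apply/seteqP; split=> x /=; rewrite quot_act_class.
Qed.

End quotient_action.

Section quotient_measure.
Context (H : groupType) d (T : measurableType d) (R : realType).
Context (a : borel_action H T) (m : {measure set T -> \bar R}).
Context (D : set T) (mD : measurable D).

(* For a fundamental domain D of a, this is the restriction of m to D
   transported along the identification of D with the orbit space; it does not
   depend on D when a preserves m and H is countable. *)
Definition quot_measure : set (orbit_space a) -> \bar R :=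
  pushforward (mrestr m mD) (orbit_class a).

Let quot_measure0 : quot_measure set0 = 0%E.
Proof. by rewrite /quot_measure /pushforward preimage_set0 measure0. Qed.

Let quot_measure_ge0 A : (0 <= quot_measure A)%E.
Proof. exact: measure_ge0. Qed.

Let quot_measure_sigma_additive : semi_sigma_additive quot_measure.
Proof.
pose nu := measure_function_pushforward__canonical__measure_function_Measure
  (mrestr m mD) (@measurable_orbit_class _ _ _ a).
exact: (@measure_semi_sigma_additive _ _ _ nu).
Qed.

HB.instance Definition _ := isMeasure.Build _ _ _ quot_measure
  quot_measure0 quot_measure_ge0 quot_measure_sigma_additive.

Definition quot_finite_measure (_ : (m D < +oo)%E) := quot_measure.

Context (finD : (m D < +oo)%E).

HB.instance Definition _ := Measure.on (quot_finite_measure finD).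

Let quot_measure_fin : fin_num_fun (quot_finite_measure finD).
Proof.
apply: lty_fin_num_fun.
by rewrite -[X in (X < _)%E]/(m ([set: T] `&` D)) setTI.
Qed.

HB.instance Definition _ :=
  Measure_isFinite.Build _ _ _ (quot_finite_measure finD) quot_measure_fin.

End quotient_measure.

Section measured_actions.
Context (H : groupType) d (T : measurableType d) (R : realType).

Definition measure_preserving (a : borel_action H T)
    (m : set T -> \bar R) : Prop :=
  forall h A, measurable A -> m (a h @^-1` A) = m A.

Definition fundamental_domain (a : borel_action H T)
    (m : set T -> \bar R) (D : set T) : Prop :=
  [/\ measurable D,
      m.-negligible (~` \bigcup_h (a h @` D)) &
      forall g h, g != h -> m.-negligible ((a g @` D) `&` (a h @` D))].

Definition ergodic (a : borel_action H T) (m : set T -> \bar R) : Prop :=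
  forall A, measurable A -> (forall h, a h @^-1` A = A) ->
    m A = 0%E \/ m (~` A) = 0%E.

Definition almost_equivariant d' (S : measurableType d')
    (m : set T -> \bar R) (a : borel_action H T) (b : borel_action H S)
    (f : T -> S) : Prop :=
  forall h, {ae m, forall x, f (a h x) = b h (f x)}.

End measured_actions.

(* Ergodicity only depends on the null sets, so a finite measure need not be
   normalized first. *)
Definition weakly_mixing (H : groupType) d (T : measurableType d)
    (R : realType) (a : borel_action H T)
    (m : {finite_measure set T -> \bar R}) : Prop :=
  ergodic (act_diag a) (m \x m)%E.

Section translation.
Context (Gam Lam : groupType) d (G : borelGroupType d).
Context (pi : UMagmaMorphism.type Gam G) (rho : UMagmaMorphism.type Lam G).

Program Definition translation_act : borel_action (Gam * Lam)%type G :=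
  BorelAction (act_fun := fun gl x => pi gl.1 * x * (rho gl.2)^-1) _ _ _.
Next Obligation. by move=> x /=; rewrite !gmulf1 invg1 mul1g mulg1. Qed.
Next Obligation. by move=> g h x /=; rewrite !gmulfM invgM !mulgA. Qed.
Next Obligation.
move=> gl /=.
have mmul (u v : G -> G) : measurable_fun [set: G] u ->
    measurable_fun [set: G] v -> measurable_fun [set: G] (fun x => u x * v x).
  by move=> mu mv; exact: measurableT_comp (@measurable_mulg _ G)
    (measurable_fun_pair mu mv).
by do 2! (apply: (mmul); rewrite //=).
Qed.

End translation.

(* The fundamental domains Y for Gamma and X for Lambda are kept as data; the
   measures they induce on the quotients do not depend on their choice. *)
Record coupling (Gam Lam : groupType) (R : realType) d (Sig : measurableType d)
    (m : {sigma_finite_measure set Sig -> \bar R}) := Coupling {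
  coupling_act :> borel_action (Gam * Lam)%type Sig ;
  coupling_standard : standard_borel R Sig ;
  coupling_preserving : measure_preserving coupling_act m ;
  coupling_Y : set Sig ;
  coupling_X : set Sig ;
  coupling_Y_domain : fundamental_domain (act_left coupling_act) m coupling_Y ;
  coupling_X_domain : fundamental_domain (act_right coupling_act) m coupling_X ;
  coupling_Y_finite : (m coupling_Y < +oo)%E ;
  coupling_X_finite : (m coupling_X < +oo)%E
}.

Section coupling_quotients.
Context (Gam Lam : groupType) (R : realType) d (Sig : measurableType d).
Context (m : {sigma_finite_measure set Sig -> \bar R}) (C : coupling Gam Lam m).

(* The full orbit space: Y meets only almost every orbit exactly once, so Y itself
   would only carry an almost everywhere defined action of Lambda. *)
Definition quotient_Gam := orbit_space (act_left C).

Lemma coupling_Y_measurable : measurable (coupling_Y C).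
Proof. by case: (coupling_Y_domain C). Qed.

Definition quotient_Gam_measure : {finite_measure set quotient_Gam -> \bar R} :=
  quot_finite_measure coupling_Y_measurable (coupling_Y_finite C).

Definition quotient_Gam_act : borel_action Lam quotient_Gam :=
  quot_act (act_left_right C).

(* Sigma x_Lambda Sigma; the diagonal action of Lambda on Sigma x Sigma has
   fundamental domain X x Sigma. *)
Definition fibre_square := orbit_space (act_diag (act_right C)).

Lemma fibre_square_domain_measurable :
  measurable (coupling_X C `*` [set: Sig]).
Proof. by apply: measurableX => //; case: (coupling_X_domain C). Qed.

Definition fibre_square_measure : {measure set fibre_square -> \bar R} :=
  quot_measure (m \x m)%E fibre_square_domain_measurable.

Lemma fibre_square_commute : actions_commute (act_diag (act_right C))
  (act_prod (act_left C) (act_left C)).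
Proof. by move=> l [g1 g2] [x y]; congr pair; rewrite act_left_right. Qed.

Definition fibre_square_act :
    borel_action (Gam * Gam)%type fibre_square :=
  quot_act fibre_square_commute.

End coupling_quotients.

(* Main.v *)
Require Import Defs.
From HB Require Import structures.
From mathcomp Require Import all_boot all_order all_algebra.
From mathcomp Require Import all_classical all_reals all_analysis.
From mathcomp Require Import measurable_realfun ring lra.

(* Lift the given map to F : Sig * Sig -> G.  As G is abelian, the cocycle
   F(x,y) F(y,z) F(x,z)^-1 is invariant under the three actions of Gam, so it
   descends to a Lam-invariant function on the cube of Sig/Gam.  The cube is
   ergodic because the product of a weakly mixing and an ergodic action is
   ergodic, so the cocycle is a constant c.  For almost every base point w this
   gives F(x,y) = Phi(x) c Phi(y)^-1 with Phi(x) = F(w,x)^-1; Phi inherits the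
   Gam-equivariance of F, and the Lam-invariance of F forces
   Phi(l x) Phi(x)^-1 to be almost everywhere constant: this is rho(l)^-1.

   The ergodicity of a product T * Z is obtained without spectral theory.  If A
   is an invariant set, then mu(A^z) and zeta(A_x & A_x') are a.e. constant by
   ergodicity of Z and of T * T.  This determines the first two moments of
   z |-> mu(A^z & B) for every B, and they are those of a constant function.
   Hence A, if not null, meets every rectangle in a fixed positive proportion
   of its measure, thus every measurable set too; taking the complement of A
   shows that A is conull. *)

Set Implicit Arguments.
Unset Strict Implicit.
Unset Printing Implicit Defensive.

Import Order.TTheory GRing.Theory Num.Theory.

Local Open Scope classical_set_scope.
Local Open Scope ring_scope.

(** * Null sets and products *)

(* The library's canonical structures of [m1 \x m2] beyond that of a measure
   only apply to subprobabilities, hence these aliases. *)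
Section sigma_finite_product.
Context d1 d2 (T1 : measurableType d1) (T2 : measurableType d2) (R : realType).
Context (m1 : {sigma_finite_measure set T1 -> \bar R}).
Context (m2 : {sigma_finite_measure set T2 -> \bar R}).

Definition sigma_finite_product : set (T1 * T2) -> \bar R := (m1 \x m2)%E.

HB.instance Definition _ := Measure.on sigma_finite_product.

Let sigma_finite_productT : sigma_finite [set: T1 * T2] sigma_finite_product.
Proof.
have [F TF mF] := sigma_finiteT m1; have [G TG mG] := sigma_finiteT m2.
(* Every pair of indices has a code; a number that codes no pair repeats the rectangle of index
   [(0, 0)], which is harmless in a union. *)
pose index n := odflt (0, 0)%N (unpickle n).
exists (fun n => F (index n).1 `*` G (index n).2) => [|n].
  apply/seteqP; split=> // -[x y] _.
  have [i _ Fx] : (\bigcup_i F i) x by rewrite -TF.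
  have [j _ Gy] : (\bigcup_i G i) y by rewrite -TG.
  by exists (pickle (i, j)) => //; rewrite /index pickleK.
have [mFn finF] := mF (index n).1; have [mGn finG] := mG (index n).2.
split; first exact: measurableX.
rewrite /sigma_finite_product product_measure1E// lte_mul_pinfty//.
by rewrite ge0_fin_numE.
Qed.

HB.instance Definition _ := Measure_isSigmaFinite.Build _ _ _
  sigma_finite_product sigma_finite_productT.

End sigma_finite_product.

Section finite_product.
Context d1 d2 (T1 : measurableType d1) (T2 : measurableType d2) (R : realType).
Context (m1 : {finite_measure set T1 -> \bar R}).
Context (m2 : {finite_measure set T2 -> \bar R}).

Definition finite_product : set (T1 * T2) -> \bar R := (m1 \x m2)%E.

HB.instance Definition _ := Measure.on finite_product.

Let fin_num_finite_product : fin_num_fun finite_product.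
Proof.
apply: lty_fin_num_fun; rewrite -setXTT [ltLHS]product_measure1E//.
by rewrite lte_mul_pinfty// ?fin_num_measure// -ge0_fin_numE// fin_num_measure.
Qed.

HB.instance Definition _ := Measure_isFinite.Build _ _ _
  finite_product fin_num_finite_product.

End finite_product.

(** Inverting an injection of [A] into [nat] gives the enumeration. Only an inclusion is claimed, so
    that the filler [x0] may lie outside [A] and [A] may be empty. *)
Lemma countable_enum (T : choiceType) (x0 : T) (A : set T) : countable A ->
  exists e : nat -> T, A `<=` range e.
Proof.
move=> /countable_injP[i inj_i].
exists (fun n => xget x0 [set x | A x /\ i x = n]) => x Ax; exists (i x) => //.
case: xgetP => [y _ /= [Ay e]|/(_ x)[]//].
by apply: inj_i e; rewrite inE.
Qed.

Section almost_everywhere.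
Context d (T : measurableType d) (R : realType).
Implicit Types (m : {measure set T -> \bar R}) (A B : set T).

Lemma ae_measure0P m A : measurable A ->
  {ae m, forall x, ~ A x} <-> m A = 0%E.
Proof.
move=> mA; rewrite -(negligibleP _ mA) /almost_everywhere/=.
by rewrite /prop_near1 /nbhs/= /almost_everywhere setCK.
Qed.

Lemma ae_forall_countable m (I : choiceType) (i0 : I) (P : I -> T -> Prop) :
  countable [set: I] -> (forall i, {ae m, forall x, P i x}) ->
  {ae m, forall x, forall i, P i x}.
Proof.
move=> /(countable_enum i0)[e eP] aP.
have : {ae m, forall x, forall n, P (e n) x} by exact: ae_foralln.
by apply: filterS => x Px i; have [n _ <-] := eP i Logic.I.
Qed.

Lemma ae_eq_measure m A B : measurable A -> measurable B ->
  {ae m, forall x, A x <-> B x} -> m A = m B.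
Proof.
move=> mA mB [N [mN N0 AB]].
have le C D : measurable C -> measurable D -> C `\` D `<=` N -> (m C <= m D)%E.
  move=> mC mD CD; rewrite -[leRHS]adde0 -N0.
  apply: le_trans (measureU2 _ mD mN); apply: le_measure; rewrite ?inE//.
    exact: measurableU.
  by move=> x Cx; have [Dx|nDx] := pselect (D x); [left|right; exact: CD].
apply/eqP; rewrite eq_le; apply/andP; split; apply: le => // x [xA nxB];
  by apply: AB => /= -[]; tauto.
Qed.

Lemma ae_exists m (P : T -> Prop) : m [set: T] <> 0%E ->
  {ae m, forall x, P x} -> exists x, P x.
Proof.
move=> m0 aP; apply: contrapT => nP; apply: m0.
apply/ae_measure0P => //; move: aP; apply: filterS => x Px _.
by apply: nP; exists x.
Qed.

End almost_everywhere.

(** Weaker than preserving the measure: only null sets have to correspond. The projection of a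
    coupling onto a quotient has this property even when it sends an infinite measure to a finite
    one, and it is enough to move almost everywhere statements both ways. *)
Definition null_equivalence d1 d2 (T1 : measurableType d1)
    (T2 : measurableType d2) (R : realType) (m1 : set T1 -> \bar R)
    (m2 : set T2 -> \bar R) (f : T1 -> T2) : Prop :=
  measurable_fun [set: T1] f /\
  forall A, measurable A -> m1 (f @^-1` A) = 0%E <-> m2 A = 0%E.

Section null_equivalence.
Context d1 d2 (T1 : measurableType d1) (T2 : measurableType d2) (R : realType).
Context (m1 : {measure set T1 -> \bar R}) (m2 : {measure set T2 -> \bar R}).
Context (f : T1 -> T2) (mf : null_equivalence m1 m2 f).

Lemma null_equivalence_preimage A : measurable A -> measurable (f @^-1` A).
Proof. by move=> mA; rewrite -[_ @^-1` _]setTI; exact: mf.1. Qed.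

Lemma ae_preimage (P : T2 -> Prop) :
  {ae m2, forall y, P y} -> {ae m1, forall x, P (f x)}.
Proof.
move=> [A [mA A0 PA]]; exists (f @^-1` A); split.
- exact: null_equivalence_preimage.
- exact/(mf.2 _ mA).
- by move=> x /=; apply: PA.
Qed.

(** Measurability of [A] matters here: the exceptional set upstairs has to be exactly the preimage
    of the complement of [A]. *)
Lemma ae_image A : measurable A ->
  {ae m1, forall x, A (f x)} -> {ae m2, forall y, A y}.
Proof.
move=> mA aA; have mCA := measurableC mA.
have : {ae m2, forall y, ~ (~` A) y}; last first.
  by apply: filterS => y /contrapT.
apply/(ae_measure0P _ mCA)/(mf.2 _ mCA)/ae_measure0P.
  exact: null_equivalence_preimage.
by apply: filterS aA => x Ax /(_ Ax).
Qed.

End null_equivalence.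

Section product.
Context d1 d2 (T1 : measurableType d1) (T2 : measurableType d2) (R : realType).
Context (m1 : {sigma_finite_measure set T1 -> \bar R}).
Context (m2 : {sigma_finite_measure set T2 -> \bar R}).

(** The product measure integrates the measures of the sections, and the integral of a nonnegative
    function vanishes only if the function does almost everywhere. *)
Lemma product_measure_eq0 A : measurable A ->
  (m1 \x m2)%E A = 0%E <-> {ae m1, forall x, m2 (xsection A x) = 0%E}.
Proof.
move=> mA; have mphi := measurable_fun_xsection m2 mA.
have := ae_eq_integral_abs m1 measurableT mphi.
rewrite (eq_integral (m2 \o xsection A))//; last first.
  by move=> x _; rewrite gee0_abs.
move=> E; split.
  by move=> /E; apply: filterS => x; exact.
by move=> aA; apply/E; apply: filterS aA => x + _.
Qed.

Lemma ae_section (P : T1 * T2 -> Prop) : {ae (m1 \x m2)%E, forall z, P z} ->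
  {ae m1, forall x, {ae m2, forall y, P (x, y)}}.
Proof.
move=> [A [mA A0 PA]]; have /(product_measure_eq0 mA) := A0.
apply: filterS => x Ax0; exists (xsection A x); split => //.
  exact: measurable_xsection.
by move=> y /= nP; rewrite -/(_ _) /xsection/= inE; exact: PA.
Qed.

Lemma ae_fst (P : T1 -> Prop) : {ae m1, forall x, P x} ->
  {ae (m1 \x m2)%E, forall z, P z.1}.
Proof.
move=> [A [mA A0 PA]]; exists (A `*` setT); split; first exact: measurableX.
  by rewrite product_measure1E// [X in (X * _)%E]A0 mul0e.
by move=> [x y]/= nP; split=> //; exact: PA.
Qed.

Lemma ae_snd (P : T2 -> Prop) : {ae m2, forall x, P x} ->
  {ae (m1 \x m2)%E, forall z, P z.2}.
Proof.
move=> [A [mA A0 PA]]; exists (setT `*` A); split; first exact: measurableX.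
  by rewrite product_measure1E// [X in (_ * X)%E]A0 mule0.
by move=> [x y]/= nP; split=> //; exact: PA.
Qed.

End product.

(** Sections of the preimage are preimages of sections, so [g] matches the null sections and [f]
    then matches the sets of base points over which the section is null. *)
Lemma null_equivalence_prod d1 d2 d3 d4 (T1 : measurableType d1)
    (T2 : measurableType d2) (T3 : measurableType d3) (T4 : measurableType d4)
    (R : realType) (m1 : {sigma_finite_measure set T1 -> \bar R})
    (m2 : {sigma_finite_measure set T2 -> \bar R})
    (m3 : {sigma_finite_measure set T3 -> \bar R})
    (m4 : {sigma_finite_measure set T4 -> \bar R})
    (f : T1 -> T3) (g : T2 -> T4) :
  null_equivalence m1 m3 f -> null_equivalence m2 m4 g ->
  null_equivalence (m1 \x m2)%E (m3 \x m4)%E (fun z => (f z.1, g z.2)).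
Proof.
move=> nf ng.
have mfg : measurable_fun setT (fun z : T1 * T2 => (f z.1, g z.2)).
  apply: measurable_fun_pair => /=.
  - exact: measurableT_comp nf.1 measurable_fst.
  - exact: measurableT_comp ng.1 measurable_snd.
split=> // A mA; set A' := _ @^-1` A.
have mA' : measurable A' by rewrite /A' -[_ @^-1` _]setTI; exact: mfg.
have mB : measurable [set y | m4 (xsection A y) = 0%E].
  rewrite -[X in measurable X]setTI.
  exact: (measurable_fun_xsection m4 mA measurableT
    (measurable_realfun.emeasurable_set1 0%E)).
have E x : xsection A' x = g @^-1` xsection A (f x).
  by apply/seteqP; split => y; rewrite /xsection/= !inE.
have E0 x : m2 (xsection A' x) = 0%E <-> m4 (xsection A (f x)) = 0%E.
  by rewrite E; apply: ng.2; exact: measurable_xsection.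
split=> [/(product_measure_eq0 _ _ mA') h|/(product_measure_eq0 _ _ mA) h].
  apply/(product_measure_eq0 _ _ mA); apply: (ae_image nf mB).
  by apply: filterS h => x /E0.
apply/(product_measure_eq0 _ _ mA').
by move: (ae_preimage nf h); apply: filterS => x /E0.
Qed.

Lemma null_equivalence_act (H : groupType) d (T : measurableType d)
    (R : realType) (m : {measure set T -> \bar R}) (a : borel_action H T) h :
  measure_preserving a m -> null_equivalence m m (a h).
Proof.
by move=> pm; split; [exact: measurable_act|move=> A mA; rewrite pm].
Qed.

(** * Ergodicity and almost everywhere constant functions *)

(** This property of a standard Borel space suffices to make invariant functions constant and to
    make the set where two functions agree measurable. *)
Definition countably_separated d (S : measurableType d) : Prop :=
  exists2 E : nat -> set S, forall n, measurable (E n) &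
    forall x y, (forall n, E n x <-> E n y) -> x = y.

Lemma countably_separated_real (R : realType) : countably_separated R.
Proof.
pose E n : set R := [set x | (x < ratr (odflt 0%R (unpickle n)))%R].
exists E.
  move=> n; rewrite /E (_ : [set _ | _] =
      `]-oo, (ratr (odflt 0%R (unpickle n)))[%classic).
    exact: measurable_itv.
  by apply/seteqP; split => x /=; rewrite in_itv.
suff lt_neq x y : (x < y)%R -> ~ forall n, E n x <-> E n y.
  move=> x y xy; have [//|xney] := eqVneq x y.
  by move: xney; rewrite neq_lt => /orP[] /lt_neq[]// n; rewrite xy.
move=> /rat_in_itvoo[q]; rewrite in_itv => /andP[xq qy] /(_ (pickle q)).
by rewrite /E/= pickleK/= => -[/(_ xq)]; rewrite lt_gtF.
Qed.

(** The separating sets are interiors of balls centred on a dense sequence with radii [1/(j+1)];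
    interiors are taken because a [ball] need not be open. *)
Lemma countably_separated_standard_borel (R : realType) d
    (S : measurableType d) : standard_borel R S -> countably_separated S.
Proof.
move=> [P [f [hP [D cD dD] bf mE]]].
have [e De] := countable_enum (f point) cD.
have fK A : f @` (f @^-1` A) = A.
  by case: bf => g _ gK; rewrite image_preimage// -subTset => x _; exists (g x).
pose U n := let: (i, j) := odflt (0%N, 0%N) (unpickle n) in
  (ball (e i) (j.+1%:R^-1))°.
exists (fun n => f @^-1` U n).
  move=> n; apply/mE; rewrite fK; apply: sub_sigma_algebra.
  by rewrite /U; case: (odflt _ _) => i j; exact: open_interior.
move=> x y xy; apply: (bij_inj bf); apply: contrapT => /eqP fxy.
move: hP; rewrite ball_hausdorff => /(_ _ _ fxy)[[r s]] /= /eqP rs0.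
(* With [eps < r/2] and a centre within [eps/2] of [f x], a point [f y] within [eps] of that centre
   lies in the [r]-ball about [f x], against the disjointness of the two balls. *)
have [k] := ltr_add_invr (divr_gt0 (gt0 r) (ltr0n R 2)); rewrite add0r.
set eps := (k.+1%:R^-1 : R) => kr; have eps0 : (0 < eps)%R by rewrite invr_gt0.
have eps20 : (0 < eps / 2)%R by rewrite divr_gt0.
have [p [/interior_subset xp]] : (ball (f x) (eps / 2))° `&` range e !=set0.
  have [p [xp /De ep]] : (ball (f x) (eps / 2))° `&` D !=set0.
    apply: dD; last exact: open_interior.
    by exists (f x); apply: nbhsx_ballx.
  by exists p.
move=> [i _ ip]; move: xp; rewrite -{p}ip => xei.
have [/= + _] := xy (pickle (i, k)); rewrite /U pickleK/= => Ey.
have /interior_subset eiy : (ball (e i) eps)° (f y).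
  apply: Ey; apply: filterS (nbhsx_ballx (f x) (eps / 2) eps20) => z xz.
  by rewrite -/eps (splitr eps); apply: ball_triangle xz; exact: ball_sym.
suff : (ball (f x) r%:num `&` ball (f y) s%:num) (f y) by rewrite rs0.
split; last exact: ballxx.
apply: (@le_ball _ _ _ (eps / 2 + eps)); last exact: ball_triangle eiy.
rewrite (splitr r%:num) lerD// ltW// (lt_trans _ kr)//.
by rewrite gtr_pMr// invf_lt1 ?ltr1n.
Qed.

Lemma measurable_forall_countable (I : Type) d (T : measurableType d)
    (F : I -> set T) : countable [set: I] -> (forall i, measurable (F i)) ->
  measurable [set x | forall i, F i x].
Proof.
move=> cI mF; rewrite (_ : [set _ | _] = ~` \bigcup_i (~` F i)).
  by apply/measurableC/countable_bigcupT_measurable => // i; exact: measurableC.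
rewrite setC_bigcup; apply/seteqP; split=> x /= Fx.
  by move=> i _ /=; apply; exact: Fx.
by move=> i; apply: contrapT; exact: Fx.
Qed.

(** By ergodicity each separating set contains [f x] for almost every [x] or for almost none; hence
    almost all values are separated from one another by no [E n]. *)
Lemma ergodic_ae_constant (H : groupType) d (T : measurableType d)
    (R : realType) (m : {measure set T -> \bar R}) (a : borel_action H T)
    d' (S : measurableType d') (f : T -> S) :
  countable [set: H] -> ergodic a m -> countably_separated S ->
  measurable_fun [set: T] f ->
  (forall h, {ae m, forall x, f (a h x) = f x}) ->
  exists c, {ae m, forall x, f x = c}.
Proof.
move=> cH erg [E mE sepE] mf /(ae_forall_countable (1%g : H) cH) inv.
have mfE n : measurable (f @^-1` E n).
  by rewrite -[X in measurable X]setTI; exact: mf.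
have dich n : exists Q : Prop, {ae m, forall x, E n (f x) <-> Q}.
  (* [ergodic] speaks of strictly invariant sets, so the almost invariant preimage of [E n] is
     replaced by the points whose whole orbit lies in it. *)
  pose A := [set x | forall h, E n (f (a h x))].
  have mA : measurable A.
    apply: measurable_forall_countable => // h.
    by rewrite -[X in measurable X]setTI; exact: measurable_act (mfE n).
  have iA h : a h @^-1` A = A.
    apply/seteqP; split=> x /= Ax g; last by rewrite -actM; exact: Ax.
    by have := Ax (g * h^-1)%g; rewrite -actM mulgVK.
  have aA : {ae m, forall x, A x <-> E n (f x)}.
    apply: filterS inv => x fx; split=> [/(_ 1%g)|Ex h]; first by rewrite act1.
    by rewrite fx.
  have [/(ae_measure0P _ mA) A0|] := erg A mA iA.
    by exists False; apply: filterS2 A0 aA => x; tauto.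
  move=> /(ae_measure0P _ (measurableC mA)) A0.
  by exists True; apply: filterS2 A0 aA => x /= /contrapT; tauto.
have [Q /ae_foralln aQ] := choice dich.
have [/measure0_ae m0|m0] := pselect (m [set: T] = 0%E); first by exists point.
have [x0 Ex0] := ae_exists m0 aQ.
exists (f x0); apply: filterS aQ => x Ex; apply: sepE => n.
by rewrite Ex Ex0.
Qed.

(** * Products of weakly mixing and ergodic actions *)

(** The two moments force the integral of [(f - b)^2] to vanish. *)
Lemma ae_constant_of_moments d (T : measurableType d) (R : realType)
    (m : {finite_measure set T -> \bar R}) (f : T -> R) (b : R) :
  measurable_fun [set: T] f -> (forall x, 0 <= f x) -> 0 <= b ->
  (\int[m]_x (f x)%:E = b%:E * m [set: T])%E ->
  (\int[m]_x (f x ^+ 2)%:E = (b ^+ 2)%:E * m [set: T])%E ->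
  {ae m, forall x, f x = b}.
Proof.
move=> mf f0 b0 I1 I2.
have mf2 : measurable_fun [set: T] (EFin \o (fun x => f x ^+ 2)).
  by apply/measurable_EFinP/measurable_funX.
have mg : measurable_fun [set: T] (EFin \o (fun x => (f x - b) ^+ 2)).
  by apply/measurable_EFinP/measurable_funX/measurable_funB.
have mh : measurable_fun [set: T] (EFin \o f) by exact/measurable_EFinP.
have mT : m [set: T] = (fine (m [set: T]))%:E.
  by rewrite fineK// fin_num_measure.
(* The square is expanded with nonnegative terms on both sides, so that integrals add without any
   integrability argument. *)
have : (\int[m]_x ((f x ^+ 2)%:E + (b ^+ 2)%:E) =
        \int[m]_x (((f x - b) ^+ 2)%:E + (2 * b)%:E * (f x)%:E))%E.
  by apply: eq_integral => x _; rewrite -EFinM -!EFinD; congr EFin; ring.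
rewrite ge0_integralD//; last 2 first.
- by move=> x _; rewrite lee_fin sqr_ge0.
- by move=> x _; rewrite lee_fin sqr_ge0.
rewrite ge0_integralD//; last 3 first.
- by move=> x _; rewrite lee_fin sqr_ge0.
- by move=> x _; rewrite -EFinM lee_fin !mulr_ge0.
- exact: measurable_funeM.
rewrite ge0_integralZl_EFin//; last 2 first.
- by move=> x _; rewrite lee_fin.
- by rewrite mulr_ge0.
rewrite I1 I2 integral_cst// [X in (_ + _ * X = _)%E]mT mT -!EFinM -EFinD => E.
have : (\int[m]_x `|((f x - b) ^+ 2)%:E| = 0)%E.
  under eq_integral do rewrite gee0_abs ?lee_fin ?sqr_ge0//.
  move: E; case: (integral _ _ _) => [r|//|//]; rewrite -EFinD => -[] E.
  by congr EFin; lra.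
move/(ae_eq_integral_abs m measurableT mg); apply: filterS => x /(_ Logic.I)[].
by move/eqP; rewrite sqrf_eq0 subr_eq0 => /eqP.
Qed.

Lemma product_measure_ysection d1 d2 (T1 : measurableType d1)
    (T2 : measurableType d2) (R : realType)
    (m1 : {sigma_finite_measure set T1 -> \bar R})
    (m2 : {sigma_finite_measure set T2 -> \bar R}) (A : set (T1 * T2)) :
  measurable A -> ((m1 \x m2) A = \int[m2]_y m1 (ysection A y))%E.
Proof.
move=> mA; have := indic_fubini_tonelli m1 m2 mA.
by rewrite indic_fubini_tonelli_FE// indic_fubini_tonelli_GE.
Qed.

Section constant_correlations.
Context d1 d2 (T : measurableType d1) (Z : measurableType d2) (R : realType).
Context (mu : {finite_measure set T -> \bar R}).
Context (zeta : {finite_measure set Z -> \bar R}).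
Context (A : set (T * Z)) (mA : measurable A).

Let fib B z : R := fine (mu (ysection A z `&` B)).

Let mfib_set B : measurable B -> measurable (A `&` (B `*` [set: Z])).
Proof. by move=> mB; apply: measurableI => //; exact: measurableX. Qed.

Let ysectionIB B z : ysection (A `&` (B `*` [set: Z])) z = ysection A z `&` B.
Proof.
rewrite ysectionI; congr (_ `&` _); rewrite ysectionE.
by apply/seteqP; split=> x //= [].
Qed.

Let fibE B z : measurable B -> mu (ysection A z `&` B) = (fib B z)%:E.
Proof.
move=> mB; rewrite fineK// fin_num_measure// -ysectionIB.
by apply: measurable_ysection; exact: mfib_set.
Qed.

Let fib_ge0 B z : 0 <= fib B z. Proof. exact: fine_ge0. Qed.

Let measurable_fib B : measurable B -> measurable_fun [set: Z] (fib B).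
Proof.
move=> mB.
rewrite [fib B](_ : _ = fine \o (mu \o ysection (A `&` (B `*` setT)))).
  apply: measurableT_comp; first exact: fine_measurable.
  by apply: measurable_fun_ysection; exact: mfib_set.
by apply/funext => z /=; rewrite ysectionIB.
Qed.

Context (c k : R) (fib_cst : {ae zeta, forall z, mu (ysection A z) = c%:E}).
Context (corr_cst : {ae (mu \x mu)%E, forall p,
  zeta (xsection A p.1 `&` xsection A p.2) = k%:E}).

(** Both sides are the measure of [W], computed by Tonelli in the two orders: for fixed [z] the
    section is a rectangle, for fixed [(x, x')] in [B * B'] it has measure [k]. *)
Let fib_corr B B' : measurable B -> measurable B' ->
  (\int[zeta]_z (fib B z * fib B' z)%:E = k%:E * (mu B * mu B'))%E.
Proof.
move=> mB mB'.
pose W := [set q : (T * T) * Z | (A (q.1.1, q.2) /\ B q.1.1) /\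
  (A (q.1.2, q.2) /\ B' q.1.2)].
have mW : measurable W.
  have mpre (g : (T * T) * Z -> T * Z) (C : set (T * Z)) :
      measurable_fun setT g -> measurable C -> measurable (g @^-1` C).
    by move=> mg mC; rewrite -[X in measurable X]setTI; exact: mg.
  rewrite (_ : W = (fun q => (q.1.1, q.2)) @^-1` (A `&` (B `*` setT)) `&`
                   (fun q => (q.1.2, q.2)) @^-1` (A `&` (B' `*` setT))).
    apply: measurableI; apply: mpre; try exact: mfib_set.
      apply: measurable_fun_pair => //.
      exact: measurableT_comp measurable_fst measurable_fst.
    apply: measurable_fun_pair => //.
    exact: measurableT_comp measurable_snd measurable_fst.
  by apply/seteqP; split=> -[[x x'] z] /=; rewrite /W/=; tauto.
have E1 z : (mu \x mu)%E (ysection W z) = (fib B z * fib B' z)%:E.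
  have -> : ysection W z = (ysection A z `&` B) `*` (ysection A z `&` B').
    by apply/seteqP; split=> -[x x'] /=; rewrite !ysectionE.
  rewrite EFinM -!fibE//; apply: product_measure1E; rewrite -ysectionIB;
    by apply: measurable_ysection; exact: mfib_set.
have E2 p : zeta (xsection W p) =
    (zeta (xsection A p.1 `&` xsection A p.2) * (\1_(B `*` B') p)%:E)%E.
  rewrite indicE; case: (boolP (p \in B `*` B')) => [/set_mem[Bp Bp']|pBB].
    rewrite mule1; congr (zeta _); rewrite !xsectionE.
    by apply/seteqP; split=> z /=; rewrite /W/=; tauto.
  rewrite mule0 (_ : xsection W p = set0) ?measure0//.
  rewrite -subset0 xsectionE => z [[_ Bp] [_ Bp']].
  by move: pBB; rewrite notin_setE; apply.
transitivity ((finite_product mu mu \x zeta) W)%E.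
  rewrite (product_measure_ysection (finite_product mu mu) zeta mW).
  apply: eq_integral => z _.
  by rewrite -E1.
have mBB : measurable (B `*` B') by exact: measurableX.
transitivity (\int[finite_product mu mu]_p (k%:E * (\1_(B `*` B') p)%:E))%E.
  apply: ae_eq_integral => //.
  - exact: measurable_fun_xsection.
  - by apply: measurable_funeM; apply/measurable_EFinP.
  - by apply: filterS corr_cst => p /= kp _; rewrite E2 kp.
rewrite integralZl//; last exact: integrable_indic.
rewrite integral_indic// setIT; congr (_ * _)%E.
exact: product_measure1E.
Qed.

Lemma null_or_conull_of_constant_correlations :
  (mu \x zeta)%E A = 0%E \/ (mu \x zeta)%E (~` A) = 0%E.
Proof.
have muE B : measurable B -> mu B = (fine (mu B))%:E.
  by move=> mB; rewrite fineK// fin_num_measure.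
have zetaE B : measurable B -> zeta B = (fine (zeta B))%:E.
  by move=> mB; rewrite fineK// fin_num_measure.
(* If [mu], [zeta] or the constant [c] vanishes, then [A] is null. Afterwards one may divide by [M]
   and [c]. *)
have [M0|M0] := eqVneq (fine (mu [set: T])) 0.
  left; apply/product_measure_eq0 => //; apply: measure0_ae.
  by rewrite [LHS]muE// M0.
have [N0|N0] := eqVneq (fine (zeta [set: Z])) 0.
  left; rewrite product_measure_ysection//; apply/eqP.
  rewrite (ae_eq_integral (cst 0%E)) ?integral0//.
  - by apply: measurable_fun_ysection.
  - by apply: measure0_ae; rewrite [LHS]zetaE// N0.
have [z0 cE] : exists z, mu (ysection A z) = c%:E.
  apply: ae_exists fib_cst => /= z0; move: N0.
  by rewrite [X in fine X](z0 : _ = _) eqxx.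
have c_ge0 : 0 <= c by rewrite -lee_fin -cE.
have [c0|c0] := eqVneq c 0.
  left; rewrite product_measure_ysection//.
  rewrite (ae_eq_integral (cst 0%E)) ?integral0//.
  - by apply: measurable_fun_ysection.
  - by apply: filterS fib_cst => z zc _; rewrite [LHS]zc c0.
right; set M := fine (mu _) in M0; set N := fine (zeta _) in N0.
have M_gt0 : 0 < M by rewrite lt_neqAle eq_sym M0 fine_ge0.
have fibTE : {ae zeta, forall z, fib [set: T] z = c}.
  by apply: filterS fib_cst => z zc; rewrite /fib setIT [X in fine X]zc.
(* The case [B' = T] of [fib_corr], where [fib B'] is almost everywhere [c]. *)
have int_fib B : measurable B ->
    (c%:E * \int[zeta]_z (fib B z)%:E = (k * (fine (mu B) * M))%:E)%E.
  move=> mB; rewrite -ge0_integralZl_EFin//; last 2 first.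
  - by move=> z _; rewrite lee_fin.
  - by apply/measurable_EFinP; exact: measurable_fib.
  rewrite !EFinM -!muE// -fib_corr//; apply: ae_eq_integral => //.
  - by apply: measurable_funeM; apply/measurable_EFinP; exact: measurable_fib.
  - by apply/measurable_EFinP; apply: measurable_funM; exact: measurable_fib.
  - by apply: filterS fibTE => z -> _; rewrite mulrC EFinM.
(* Taking also [B = T] leaves one equation, which determines [k]. *)
have kE : k = c ^+ 2 * N / M ^+ 2.
  have : (\int[zeta]_z (fib [set: T] z)%:E = (c * N)%:E)%E.
    rewrite EFinM -zetaE// -integral_cst//; apply: ae_eq_integral => //.
    - by apply/measurable_EFinP; exact: measurable_fib.
    - by apply: filterS fibTE => z -> _.
  move=> I; have := int_fib _ measurableT; rewrite I -EFinM => -[] E.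
  have {}E : c ^+ 2 * N = k * M ^+ 2 by rewrite !expr2 -mulrA; exact: E.
  by rewrite E mulfK// expf_neq0.
have fib_ae B : measurable B ->
    {ae zeta, forall z, fib B z = c * fine (mu B) / M}.
  move=> mB; apply: ae_constant_of_moments => //.
  - exact: measurable_fib.
  - by rewrite divr_ge0 ?mulr_ge0 ?fine_ge0.
  - move: (int_fib B mB); case: (integral _ _ _) => [r| |].
    + rewrite -EFinM => -[] E; rewrite zetaE// -EFinM; congr EFin.
      by apply: (mulfI c0); rewrite E kE -/N; field.
    + by rewrite gt0_muley// lte_fin lt_neqAle eq_sym c0.
    + by rewrite gt0_muleNy// lte_fin lt_neqAle eq_sym c0.
  - transitivity (\int[zeta]_z (fib B z * fib B z)%:E)%E; first by [].
    rewrite fib_corr// zetaE// muE// -!EFinM; congr EFin.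
    by rewrite kE -/N /=; field.
have rect B C : measurable B -> measurable C ->
    ((mu \x zeta) ((B `*` C) `&` A) = (c / M)%:E * (mu B * zeta C))%E.
  move=> mB mC; rewrite product_measure_ysection//; last first.
    by apply: measurableI => //; exact: measurableX.
  transitivity (\int[zeta]_z ((c * fine (mu B) / M)%:E * (\1_C z)%:E))%E.
    apply: ae_eq_integral => //.
    - apply: measurable_fun_ysection.
      by apply: measurableI => //; exact: measurableX.
    - by apply: measurable_funeM; apply/measurable_EFinP.
    - apply: filterS (fib_ae B mB) => z bE _; rewrite ysectionI indicE.
      have [Cz|nCz] := boolP (z \in C).
        by rewrite in_ysectionX// mule1 setIC [LHS]fibE// bE.
      by rewrite notin_ysectionX// set0I measure0 mule0.
  rewrite integralZl//; last exact: integrable_indic.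
  rewrite integral_indic// setIT muleA [X in (_ = _ * X * _)%E]muE// -EFinM.
  by congr (_%:E * _)%E; field.
(* By [rect], [A] fills the proportion [c / M] of each rectangle. Restricting to [A] and rescaling
   by [M / c] thus gives a measure equal to the product on rectangles, hence everywhere; it vanishes
   on the complement of [A]. *)
have Mc_ge0 : 0 <= M / c by rewrite divr_ge0// ltW.
pose nu := mscale (NngNum Mc_ge0) (mrestr (mu \x zeta)%E mA).
have nuE X : measurable X -> (mu \x zeta)%E X = nu X.
  apply: product_measure_unique => B C mB mC.
  rewrite /nu /mscale /mrestr/= [X in (_ * X = _)%E](rect _ _ mB mC).
  rewrite muleA -EFinM.
  by rewrite mulrA divfK// divff// mul1e.
rewrite nuE; last exact: measurableC.
have mA0 : mrestr (mu \x zeta)%E mA (~` A) = 0%E.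
  by rewrite /mrestr setICl measure0.
by rewrite /nu /mscale [X in (_ * X)%E]mA0 mule0.
Qed.

End constant_correlations.

(** Unlike in [act_prod], a single group acts on both factors; for equal factors the maps are those
    of [act_diag]. *)
Program Definition act_joint (H : groupType) d1 d2 (T : measurableType d1)
    (Z : measurableType d2) (a : borel_action H T) (b : borel_action H Z) :
    borel_action H (T * Z)%type :=
  BorelAction (act_fun := fun h p => (a h p.1, b h p.2)) _ _ _.
Next Obligation. by move=> H d1 d2 T Z a b [x y] /=; rewrite !act1. Qed.
Next Obligation. by move=> H d1 d2 T Z a b g h [x y] /=; rewrite !actM. Qed.
Next Obligation.
move=> H d1 d2 T Z a b h; apply: measurable_fun_pair => /=.
- exact: measurableT_comp (measurable_act a h) measurable_fst.
- exact: measurableT_comp (measurable_act b h) measurable_snd.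
Qed.

(** The pushforward agrees with the product measure on rectangles, which determine it. *)
Lemma measure_preserving_joint (H : groupType) d1 d2 (T : measurableType d1)
    (Z : measurableType d2) (R : realType)
    (mu : {sigma_finite_measure set T -> \bar R})
    (zeta : {sigma_finite_measure set Z -> \bar R})
    (a : borel_action H T) (b : borel_action H Z) :
  measure_preserving a mu -> measure_preserving b zeta ->
  measure_preserving (act_joint a b) (mu \x zeta)%E.
Proof.
move=> pa pb h A mA; have mh := measurable_act (act_joint a b) h.
have -> : (mu \x zeta)%E A = pushforward (mu \x zeta)%E (act_joint a b h) A.
  pose nu := measure_function_pushforward__canonical__measure_function_Measure
    (mu \x zeta)%E mh.
  apply: (product_measure_unique (m' := nu)) => // B C mB mC.
  rewrite -(pa h B mB) -(pb h C mC) -product_measure1E//.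
  - by rewrite -[X in measurable X]setTI; exact: measurable_act.
  - by rewrite -[X in measurable X]setTI; exact: measurable_act.
by [].
Qed.

(** For an invariant [A], the fibre measure is invariant on [Z] and the correlation of two sections
    is invariant on [T * T]; both are constant by ergodicity, so
    [null_or_conull_of_constant_correlations] applies. *)
Lemma ergodic_joint (H : groupType) d1 d2 (T : measurableType d1)
    (Z : measurableType d2) (R : realType)
    (mu : {finite_measure set T -> \bar R})
    (zeta : {finite_measure set Z -> \bar R})
    (a : borel_action H T) (b : borel_action H Z) :
  countable [set: H] -> measure_preserving a mu -> measure_preserving b zeta ->
  weakly_mixing a mu -> ergodic b zeta ->
  ergodic (act_joint a b) (mu \x zeta)%E.
Proof.
move=> cH pa pb wma eb A mA iA.
have iAE h t z : A (a h t, b h z) <-> A (t, z).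
  by rewrite -[in X in _ <-> X](iA h).
pose D := [set q : (T * T) * Z | A (q.1.1, q.2) /\ A (q.1.2, q.2)].
have mD : measurable D.
  have mpre (g : (T * T) * Z -> T * Z) : measurable_fun setT g ->
      measurable (g @^-1` A).
    by move=> mg; rewrite -[X in measurable X]setTI; exact: mg.
  rewrite (_ : D = (fun q => (q.1.1, q.2)) @^-1` A `&`
                   (fun q => (q.1.2, q.2)) @^-1` A)//.
  apply: measurableI; apply: mpre; apply: measurable_fun_pair => //.
  - exact: measurableT_comp measurable_fst measurable_fst.
  - exact: measurableT_comp measurable_snd measurable_fst.
have DE p : xsection A p.1 `&` xsection A p.2 = xsection D p.
  by rewrite !xsectionE.
have mA1 h t : measurable (xsection A (a h t)) by exact: measurable_xsection.
have [c fibc] : exists c, {ae zeta, forall z, fine (mu (ysection A z)) = c}.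
  apply: (ergodic_ae_constant cH eb (countably_separated_real R)) => [|h].
    apply: measurableT_comp; first exact: fine_measurable.
    exact: measurable_fun_ysection.
  apply: aeW => z; congr fine; rewrite -(pa h); last exact: measurable_ysection.
  congr (mu _); apply/seteqP; split=> t /=; rewrite !ysectionE/= => /iAE//.
have [k corrk] : exists k, {ae (mu \x mu)%E, forall p,
    fine (zeta (xsection A p.1 `&` xsection A p.2)) = k}.
  apply: (ergodic_ae_constant cH wma (countably_separated_real R)) => [|h].
    apply: measurableT_comp; first exact: fine_measurable.
    under eq_fun do rewrite DE.
    exact: measurable_fun_xsection.
  apply: aeW => -[t t']; congr fine; rewrite -(pb h)/=; last first.
    by apply: measurableI; exact: measurable_xsection.
  congr (zeta _); rewrite !xsectionE.
  by apply/seteqP; split=> z /= [/iAE ? /iAE ?].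
apply: (null_or_conull_of_constant_correlations mA (c := c) (k := k)).
  apply: filterS fibc => z <-; rewrite fineK// fin_num_measure//.
  exact: measurable_ysection.
apply: filterS corrk => p <-; rewrite fineK// fin_num_measure// DE.
exact: measurable_xsection.
Qed.

(** * Fundamental domains and quotients *)

Section domains.
Context (H : groupType) (cH : countable [set: H]).
Context d (T : measurableType d) (R : realType).
Context (m : {measure set T -> \bar R}) (a : borel_action H T).
Context (pa : measure_preserving a m).

(** A pointwise form of being a fundamental domain, suited to almost everywhere arguments. *)
Definition unique_return (D : set T) (x : T) (h : H) : Prop :=
  D (a h x) /\ forall g, D (a g x) -> g = h.

Let mact h (A : set T) : measurable A -> measurable (a h @^-1` A).
Proof.
by move=> mA; rewrite -[X in measurable X]setTI; exact: measurable_act.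
Qed.

Lemma act_preimage_image h (D : set T) : a h @` D = a h^-1%g @^-1` D.
Proof.
apply/seteqP; split=> [_ [x Dx <-]|x Dx] /=; first by rewrite -actM mulVg act1.
by exists (a h^-1%g x); rewrite // -actM mulgV act1.
Qed.

Lemma measurable_unique_return D h : measurable D ->
  measurable [set x | unique_return D x h].
Proof.
move=> mD; rewrite (_ : [set _ | _] = (a h @^-1` D) `&`
    [set x | forall g, (if g == h then setT else ~` (a g @^-1` D)) x]).
  apply: measurableI; first exact: mact.
  apply: measurable_forall_countable => // g; case: ifP => // _.
  by apply/measurableC; exact: mact.
apply/seteqP; split=> x [Dx Ux]; split=> // g.
  by case: eqVneq => // /eqP gh /Ux.
by move=> Dg; have := Ux g; case: eqVneq => // _ /(_ Dg).
Qed.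

Lemma unique_return_act D x g h :
  unique_return D (a g x) h <-> unique_return D x (h * g)%g.
Proof.
rewrite /unique_return -actM; split=> -[Dx Ux]; split=> // k.
  by move=> Dk; rewrite -(Ux (k * g^-1)%g) ?mulgVK// -actM mulgVK.
by rewrite -actM => /Ux/mulIg.
Qed.

Lemma fundamental_domain_unique_return D : fundamental_domain a m D ->
  {ae m, forall x, exists h, unique_return D x h}.
Proof.
move=> [mD cov dis].
have dis' : {ae m, forall x, forall g h, g != h -> ~ (D (a g x) /\ D (a h x))}.
  apply: (ae_forall_countable (1%g : H) cH) => g.
  apply: (ae_forall_countable (1%g : H) cH) => h.
  have [gh|gh] := eqVneq g h; first exact: aeW.
  (* Returning to [D] under [g] means lying in the translate of [D] by the inverse of [g]. *)
  have : g^-1%g != h^-1%g by rewrite (inj_eq invg_inj).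
  move=> /dis; rewrite !act_preimage_image !invgK; apply: negligibleS.
  by move=> x /=; apply: contra_notP => nD _.
have cov' : {ae m, forall x, (\bigcup_h (a h @` D)) x} by [].
apply: filterS2 cov' dis' => x [h _]; rewrite act_preimage_image => Dx disx.
exists h^-1%g; split=> // g Dg; apply/eqP/negPn/negP => gh.
by apply: (disx _ _ gh).
Qed.

(** Countably many translates of the null set [C & D] cover almost all of [C]. *)
Lemma null_of_invariant_domain D C : measurable D -> measurable C ->
  {ae m, forall x, exists h, D (a h x)} ->
  (forall h x, C (a h x) <-> C x) -> m (C `&` D) = 0%E -> m C = 0%E.
Proof.
move=> mD mC cov iC CD0; apply/(ae_measure0P _ mC).
have mCD : measurable (C `&` D) by exact: measurableI.
have /(ae_forall_countable (1%g : H) cH) :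
    forall h, {ae m, forall x, ~ (C `&` D) (a h x)}.
  move=> h; move/(ae_measure0P _ mCD): CD0.
  exact: (ae_preimage (null_equivalence_act h pa)).
by apply: filterS2 cov => x [h Dx] nCD Cx; apply: (nCD h); split=> //; exact/iC.
Qed.

(** Almost every point of [B] lies in exactly one translate of [D]. The injection [i] turns the sum
    over the group into a series; numbers outside its range contribute empty sets. *)
Lemma measure_unique_return_sum (i : H -> nat) D B : injective i ->
  measurable D -> {ae m, forall x, exists h, unique_return D x h} ->
  measurable B ->
  m B = (\sum_(n <oo) m (B `&` [set x | exists2 h, i h = n & D (a h x)]))%E.
Proof.
move=> inji mD aU mB.
pose P n := [set x | exists2 h, i h = n & D (a h x)].
pose U := [set x | exists h, unique_return D x h].
have PE n : (exists2 h, i h = n & P n = a h @^-1` D) \/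
            ((forall h, i h <> n) /\ P n = set0).
  have [[h ih]|nh] := pselect (exists h, i h = n).
    left; exists h => //; apply/seteqP; split=> [x [g]|x Dx]; last by exists h.
    by rewrite -ih => /inji ->.
  right; split=> [h ih|]; first by apply: nh; exists h.
  by apply/seteqP; split=> // x [h ih _]; apply: nh; exists h.
have mP n : measurable (P n).
  by case: (PE n) => [[h _ ->]|[_ ->]]//; exact: mact.
have mU : measurable U.
  rewrite (_ : U = \bigcup_h [set x | unique_return D x h]).
    apply: countable_bigcupT_measurable => // h.
    exact: measurable_unique_return.
  by apply/seteqP; split=> x [h]; exists h.
have mBP n : measurable (B `&` P n) by exact: measurableI.
have mBPU n : measurable (B `&` P n `&` U) by exact: measurableI.
(* Intersecting with the conull set [U] makes the pieces disjoint everywhere. *)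
transitivity (m (\bigcup_n (B `&` P n `&` U))).
  apply: ae_eq_measure => //; first exact: bigcupT_measurable.
  apply: filterS aU => x Ux; split=> [Bx|[n _ [[]]]//].
  have [h [Dx _]] := Ux; exists (i h) => //; split=> //; split=> //.
  by exists h.
rewrite measure_semi_bigcup//; last 2 first.
- apply/trivIsetP => n k _ _ nk; rewrite -subset0.
  move=> x [[[_ [g gn Dg]] [h [_ Ux]]] [[_ [g' gk Dg']] _]].
  by move: nk; rewrite -gn -gk (Ux g Dg) (Ux g' Dg') eqxx.
- exact: bigcupT_measurable.
apply: eq_eseriesr => n _; apply: ae_eq_measure => //; first exact: mBP.
by apply: filterS aU => x Ux; split=> [[]|].
Qed.

(** Cut [C & D] by the translates of [D'] and [C & D'] by those of [D]; the action carries the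
    pieces of one onto pieces of the other. *)
Lemma measure_invariant_domain D D' C : measurable D -> measurable D' ->
  {ae m, forall x, exists h, unique_return D x h} ->
  {ae m, forall x, exists h, unique_return D' x h} ->
  measurable C -> (forall h x, C (a h x) <-> C x) ->
  m (C `&` D) = m (C `&` D').
Proof.
move=> mD mD' aD aD' mC iC; have /countable_injP[i inji] := cH.
have {}inji : injective i by move=> g h gh; apply: inji gh; rewrite inE.
(* Indexing the second series by inverses makes the two series agree term by term. *)
have injiV : injective (fun h => i h^-1%g) by move=> g h /inji/invg_inj.
rewrite (measure_unique_return_sum inji mD' aD'); last exact: measurableI.
rewrite (measure_unique_return_sum injiV mD aD); last exact: measurableI.
apply: eq_eseriesr => n _.
have [[h ih]|nh] := pselect (exists h, i h = n); last first.
  congr (m _); apply/seteqP; split=> x [_ [h]] hn; exfalso; apply: nh.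
    by exists h.
  by exists h^-1%g.
have -> : [set x | exists2 g, i g = n & D' (a g x)] = a h @^-1` D'.
  apply/seteqP; split=> [x [g]|x Dx]; last by exists h.
  by rewrite -ih => /inji ->.
have -> : [set x | exists2 g, i g^-1%g = n & D (a g x)] = a h^-1%g @^-1` D.
  apply/seteqP; split=> [x [g]|x Dx]; last by exists h^-1%g; rewrite ?invgK.
  by rewrite -ih => /inji <-; rewrite invgK.
rewrite -[RHS](pa h).
  congr (m _); apply/seteqP; split=> x /=; rewrite -actM mulVg act1.
    by move=> [[/iC ? ?] ?].
  by move=> [[/iC ? ?] ?].
by apply: measurableI; [exact: measurableI|exact: mact].
Qed.

End domains.

(** * A measurable section of the orbit map *)

Section orbit_section.
Context (H : groupType) (cH : countable [set: H]).
Context d (T : measurableType d) (a : borel_action H T) (D : set T).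

Let return_points x : set T := [set a h x | h in unique_return a D x].

(* Outside the union of the orbits meeting [D] in exactly one point, this takes
   the junk value [point]. *)
Definition orbit_section (O : orbit_space a) : T :=
  xget point (return_points (orbit_repr O)).

(** The return points of [x] depend only on its orbit, so the chosen representative is
    immaterial. *)
Let orbit_section_class x :
  orbit_section (orbit_class a x) = xget point (return_points x).
Proof.
rewrite /orbit_section; have [h ->] := orbit_repr_class a x; congr xget.
apply/seteqP; split=> [_ [g /unique_return_act Ug <-]|_ [g Ug <-]].
  by exists (g * h)%g; rewrite // actM.
by exists (g * h^-1)%g; rewrite /= -?actM ?mulgVK// unique_return_act mulgVK.
Qed.

Lemma orbit_sectionE x h : unique_return a D x h ->
  orbit_section (orbit_class a x) = a h x.
Proof.
move=> Uh; rewrite orbit_section_class; apply: xget_unique; first by exists h.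
by move=> _ [g [Dg _] <-]; rewrite (Uh.2 g Dg).
Qed.

Let orbit_section0 x : (forall h, ~ unique_return a D x h) ->
  orbit_section (orbit_class a x) = point.
Proof.
by move=> nU; rewrite orbit_section_class; apply: xgetPN => y [h /nU].
Qed.

Lemma measurable_orbit_section : measurable D ->
  measurable_fun [set: orbit_space a] orbit_section.
Proof.
move=> mD _ B mB; rewrite setTI.
have mU h := measurable_unique_return cH a h mD.
pose N := [set x | forall h, ~ unique_return a D x h].
have mN : measurable N.
  by apply: measurable_forall_countable => // h; exact/measurableC/mU.
rewrite /measurable/= /orbit_measurable /image_set_system /= setTI.
rewrite (_ : _ @^-1` _ =
    (\bigcup_h ([set x | unique_return a D x h] `&` a h @^-1` B)) `|`
    (N `&` [set _ | B point])).
  apply: measurableU.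
    apply: countable_bigcupT_measurable => // h; apply: measurableI => //.
    by rewrite -[X in measurable X]setTI; exact: measurable_act.
  apply: measurableI => //; have [Bp|nBp] := pselect (B point).
    by rewrite (_ : [set _ | _] = setT)//; apply/seteqP; split.
  by rewrite (_ : [set _ | _] = set0)//; apply/seteqP; split.
apply/seteqP; split=> x /=.
  have [[h Uh]|nU] := pselect (exists h, unique_return a D x h).
    by rewrite (orbit_sectionE Uh) => Bx; left; exists h.
  have Nx h : ~ unique_return a D x h by move=> Uh; apply: nU; exists h.
  by rewrite orbit_section0// => Bp; right.
move=> [[h _ [Uh]]|[/orbit_section0 ->//]].
by rewrite (orbit_sectionE Uh).
Qed.

End orbit_section.

Section quotient_measure.
Context (H : groupType) (cH : countable [set: H]).
Context d (T : measurableType d) (R : realType).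
Context (m : {measure set T -> \bar R}) (a : borel_action H T).
Context (pa : measure_preserving a m) (D : set T) (mD : measurable D).

Let orbit_class_measurable (A : set (orbit_space a)) :
  measurable A -> measurable (orbit_class a @^-1` A).
Proof.
by move=> mA; rewrite -[X in measurable X]setTI; exact: measurable_orbit_class.
Qed.

Lemma null_equivalence_orbit_class :
  {ae m, forall x, exists h, D (a h x)} ->
  null_equivalence m (quot_measure (a := a) m mD) (orbit_class a).
Proof.
move=> cov; split=> [|A mA]; first exact: measurable_orbit_class.
rewrite /quot_measure /pushforward /mrestr; split=> [A0|].
  apply: subset_measure0 A0 => //.
  - by apply: measurableI => //; exact: orbit_class_measurable.
  - exact: orbit_class_measurable.
apply: (null_of_invariant_domain cH pa) => //.
  exact: orbit_class_measurable.
by move=> h x; rewrite /= orbit_class_act.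
Qed.

(** As the actions commute, the preimage of [D] under [b k] has unique returns too, and invariant
    sets meet both domains in the same measure. *)
Lemma measure_preserving_quot_act (K : groupType) (b : borel_action K T)
    (ab : actions_commute a b) :
  {ae m, forall x, exists h, unique_return a D x h} ->
  measure_preserving b m ->
  measure_preserving (quot_act ab) (quot_measure (a := a) m mD).
Proof.
move=> aD pb k A mA; rewrite /quot_measure /pushforward /mrestr.
have mbk B : measurable B -> measurable (b k @^-1` B).
  by move=> mB; rewrite -[X in measurable X]setTI; exact: measurable_act.
have mA' := orbit_class_measurable mA.
rewrite -[RHS](pb k); last exact: measurableI.
rewrite [in LHS](_ : _ @^-1` _ = b k @^-1` (orbit_class a @^-1` A)); last first.
  by apply/seteqP; split=> x /=; rewrite quot_act_class.
apply: (measure_invariant_domain cH pa) => //; try exact: mbk.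
- move: (ae_preimage (null_equivalence_act k pb) aD).
  apply: filterS => x [h [Dx Ux]]; exists h; split=> /=; first by rewrite -ab.
  by move=> g; rewrite -ab => /Ux.
- by move=> h x /=; rewrite -ab orbit_class_act.
Qed.

End quotient_measure.

(** * Cocycles on couplings *)

(** Meant for projections [g] of a product, which pull conull sets back to conull sets; the argument
    is section by section. *)
Lemma ae_prod_map d1 d2 d3 (T1 : measurableType d1) (T2 : measurableType d2)
    (T3 : measurableType d3) (R : realType)
    (m1 : {sigma_finite_measure set T1 -> \bar R})
    (m2 : {sigma_finite_measure set T2 -> \bar R})
    (m3 : {sigma_finite_measure set T3 -> \bar R})
    (g : T3 -> T2) (P : T1 * T2 -> Prop) :
  measurable_fun [set: T3] g ->
  (forall Q : T2 -> Prop,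
    {ae m2, forall y, Q y} -> {ae m3, forall z, Q (g z)}) ->
  {ae (m1 \x m2)%E, forall p, P p} ->
  {ae (m1 \x m3)%E, forall q, P (q.1, g q.2)}.
Proof.
move=> mg ag [A [mA A0 PA]].
have mA' : measurable [set q : T1 * T3 | A (q.1, g q.2)].
  have mh : measurable_fun setT (fun q : T1 * T3 => (q.1, g q.2)).
    apply: measurable_fun_pair => //.
    exact: measurableT_comp mg measurable_snd.
  by rewrite -[X in measurable X]setTI; exact: mh.
exists [set q | A (q.1, g q.2)]; split=> //; last by move=> q /= /PA.
apply/(product_measure_eq0 m1 m3 mA').
have /(product_measure_eq0 m1 m2 mA) := A0.
apply: filterS => x /(ae_measure0P m2 (measurable_xsection x mA))/ag Ax0.
apply/(ae_measure0P m3 (measurable_xsection x mA')).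
by apply: filterS Ax0 => z; rewrite !xsectionE.
Qed.

Local Open Scope group_scope.

Section group_valued_functions.
Context dG (G : borelGroupType dG) d (T : measurableType d).
Implicit Types f g : T -> G.

Lemma measurable_fun_mulg f g : measurable_fun [set: T] f ->
  measurable_fun [set: T] g -> measurable_fun [set: T] (fun x => f x * g x).
Proof.
move=> mf mg; exact: measurableT_comp (@measurable_mulg _ G)
  (measurable_fun_pair mf mg).
Qed.

Lemma measurable_fun_invg f : measurable_fun [set: T] f ->
  measurable_fun [set: T] (fun x => (f x)^-1).
Proof. exact: measurableT_comp (@measurable_invg _ G). Qed.

End group_valued_functions.

Lemma measurable_eq_fun d d' (T : measurableType d) (S : measurableType d')
    (f g : T -> S) : countably_separated S -> measurable_fun [set: T] f ->
  measurable_fun [set: T] g -> measurable [set x | f x = g x].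
Proof.
move=> [E mE sepE] mf mg.
have mpre (h : T -> S) n :
    measurable_fun [set: T] h -> measurable (h @^-1` E n).
  by move=> mh; rewrite -[X in measurable X]setTI; exact: mh.
rewrite (_ : [set _ | _] = [set x | forall n,
    ((f @^-1` E n `&` g @^-1` E n) `|`
     (~` (f @^-1` E n) `&` ~` (g @^-1` E n))) x]).
  apply: measurable_forall_countable => // n.
  apply: measurableU; apply: measurableI; try (apply: measurableC);
  by apply: mpre.
apply/seteqP; split=> x /= fg.
  by move=> n; rewrite fg; have [|] := pselect (E n (g x)); [left|right].
by apply: sepE => n; have := fg n; tauto.
Qed.

Lemma morphism_of_mulg (H K : groupType) (r : H -> K) :
  (forall g h, r (g * h) = r g * r h) ->
  exists rho : UMagmaMorphism.type H K, forall h, rho h = r h.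
Proof.
move=> rM; have rF : {morph r : x y / x / y}.
  by move=> x y; rewrite -[in RHS](divgK y x) [in RHS]rM mulgK.
pose mix := isGroupMorphism.Build H K r rF.
pose rho : UMagmaMorphism.type H K := HB.pack r mix.
by exists rho.
Qed.

(** * From a constant cocycle to an equivariant map *)

Section trivialization.
Context (R : realType) (Gam Lam : groupType) dG (G : borelGroupType dG).
Context (Gam_countable : countable [set: Gam]).
Context (G_abelian : forall x y : G, x * y = y * x).
Context (pi : UMagmaMorphism.type Gam G).
Context d (T : measurableType d) (m : {sigma_finite_measure set T -> \bar R}).
Context (a : borel_action (Gam * Lam)%type T) (pa : measure_preserving a m).
Context (F : T * T -> G) (mF : measurable_fun [set: T * T] F).
Context (F_Lam : forall l x y, F (a (1, l) x, a (1, l) y) = F (x, y)).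
Context (F_Gam : forall g1 g2, {ae (m \x m)%E, forall p,
  F (a (g1, 1) p.1, a (g2, 1) p.2) = pi g1 * F p * (pi g2)^-1}).
Context (c : G) (F_cocycle : {ae (m \x sigma_finite_product m m)%E, forall p,
  F (p.1, p.2.1) * F (p.2.1, p.2.2) * (F (p.1, p.2.2))^-1 = c}).

Lemma almost_equivariant_of_cocycle :
  exists (rho : UMagmaMorphism.type Lam G) (Phi : T -> G),
    measurable_fun [set: T] Phi /\
    almost_equivariant m a (translation_act pi rho) Phi.
Proof.
have [m0|m0] := pselect (m [set: T] = 0%E).
  exists (@one_fun Lam G), (cst 1); split; first exact: measurable_cst.
  by move=> h; exact: measure0_ae.
have F_Gam2 : {ae (m \x m)%E, forall p, forall g,
    F (p.1, a (g, 1) p.2) = F p * (pi g)^-1}.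
  apply: (ae_forall_countable (1 : Gam) Gam_countable) => g.
  by apply: filterS (F_Gam 1 g) => p; rewrite act1 gmulf1 mul1g.
(* The base point [w] is generic for both the cocycle identity and the equivariance in the second
   variable. *)
have [w [Fw FwG]] := ae_exists m0
  (filterI (ae_section F_cocycle) (ae_section F_Gam2)).
pose Phi x := (F (w, x))^-1.
have FE : {ae (m \x m)%E, forall p, F p = Phi p.1 * c * (Phi p.2)^-1}.
  apply: filterS Fw => -[x y] /= <-.
  by rewrite /Phi invgK !mulgA mulVg mul1g mulgVK.
have pj l : null_equivalence (m \x m)%E (m \x m)%E
    (fun p => (a (1, l) p.1, a (1, l) p.2)).
  by apply: null_equivalence_prod; exact: null_equivalence_act.
have mPhi : measurable_fun [set: T] Phi.
  apply/measurable_fun_invg; apply: measurableT_comp mF _.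
  exact: measurable_pair1.
have [r rE] : exists r : Lam -> G, forall l,
    {ae m, forall x, Phi (a (1, l) x) = Phi x * r l}.
  suff : forall l, exists s, {ae m, forall x, Phi (a (1, l) x) = Phi x * s}.
    by move=> h; have [r rE] := choice h; exists r.
  (* Comparing [FE] at a pair and at its translate by [l] cancels [c]; fixing a generic first
     coordinate then isolates the factor [s]. *)
  move=> l; have : {ae (m \x m)%E, forall p,
      Phi (a (1, l) p.1) * (Phi (a (1, l) p.2))^-1 = Phi p.1 * (Phi p.2)^-1}.
    apply: filterS2 FE (ae_preimage (pj l) FE) => -[x y] /= Fxy.
    have cC u v : u * c * v = u * v * c by rewrite -!mulgA (G_abelian c).
    by rewrite F_Lam Fxy !cC => /mulIg.
  move=> /ae_section/(ae_exists m0)[x Px].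
  exists ((Phi x)^-1 * Phi (a (1, l) x)); apply: filterS Px => y /= Px.
  have : Phi (a (1, l) x) = Phi x * (Phi y)^-1 * Phi (a (1, l) y).
    by rewrite -Px mulgVK.
  by move=> ->; rewrite !mulgA mulgVK mulgV mul1g.
have rM l l' : r (l * l') = r l * r l'.
  have [x [[E1 E2] E3]] := ae_exists m0 (filterI
    (filterI (rE (l * l')) (rE l'))
    (ae_preimage (null_equivalence_act (1, l') pa) (rE l))).
  move: E1; have -> : a (1, l * l') x = a (1, l) (a (1, l') x).
    by rewrite -actM; congr (a (_, _) x); rewrite mulg1.
  by rewrite E3 E2 -mulgA => /mulgI <-; rewrite G_abelian.
have rVM l l' : (r (l * l'))^-1 = (r l)^-1 * (r l')^-1.
  by rewrite rM invgM G_abelian.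
have [rho rhoE] := morphism_of_mulg rVM.
exists rho, Phi; split=> // -[g l] /=.
have PhiG : {ae m, forall x, Phi (a (g, 1) x) = pi g * Phi x}.
  by apply: filterS FwG => x /= /(_ g); rewrite /Phi => ->; rewrite invgM invgK.
apply: filterS2 (rE l) (ae_preimage (null_equivalence_act (1, l) pa) PhiG).
move=> x rx; rewrite -actM.
rewrite (_ : (g, 1) * (1, l) = (g, l)); last first.
  by congr pair; rewrite ?mulg1 ?mul1g.
by move=> ->; rewrite rx rhoE invgK mulgA.
Qed.

End trivialization.

(** This is where the cocycle becomes invariant under three copies of [Gam]: the factor [v] cancels
    in any group, [u] and [w] by commutativity. *)
Lemma mulg_translate_cocycle (G : groupType) (u v w x y z : G) :
  (forall g h : G, g * h = h * g) ->
  u * x * v^-1 * (v * y * w^-1) * (u * z * w^-1)^-1 = x * y * z^-1.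
Proof.
move=> comm; have e t : u * t * w^-1 = t * (u * w^-1) by rewrite (comm u) mulgA.
by rewrite !mulgA mulgVK -(mulgA u x) !e invgM mulgA mulgK.
Qed.

(** * Descent of the cocycle to the cube of the quotient by [Gam] *)

Section coupling.
Context (R : realType) (Gam Lam : groupType).
Context (Gam_countable : countable [set: Gam]).
Context (Lam_countable : countable [set: Lam]).
Context d (Sig : measurableType d).
Context (m : {sigma_finite_measure set Sig -> \bar R}) (C : coupling Gam Lam m).

Let pGam : measure_preserving (act_left C) m.
Proof. by move=> g; exact: (coupling_preserving C). Qed.

Let pLam : measure_preserving (act_right C) m.
Proof. by move=> l; exact: (coupling_preserving C). Qed.

(** Bringing the first coordinate into [X] already brings the pair into the domain [X * Sig]. *)
Lemma null_equivalence_fibre_square :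
  null_equivalence (m \x m)%E (fibre_square_measure C)
    (orbit_class (act_diag (act_right C))).
Proof.
have pdiag : measure_preserving (act_diag (act_right C)) (m \x m)%E.
  exact: (measure_preserving_joint pLam pLam).
apply: (null_equivalence_orbit_class Lam_countable pdiag).
have := fundamental_domain_unique_return Lam_countable (coupling_X_domain C).
move=> /(ae_fst m); apply: filterS => z [l [Xz _]].
by exists l; split.
Qed.

Let Y_unique_return :
  {ae m, forall x, exists g, unique_return (act_left C) (coupling_Y C) x g}.
Proof.
exact: (fundamental_domain_unique_return Gam_countable (coupling_Y_domain C)).
Qed.

Lemma null_equivalence_quotient_Gam :
  null_equivalence m (quotient_Gam_measure C) (orbit_class (act_left C)).
Proof.
apply: (null_equivalence_orbit_class Gam_countable pGam).
by apply: filterS Y_unique_return => x [g [Yx _]]; exists g.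
Qed.

Lemma measure_preserving_quotient_Gam :
  measure_preserving (quotient_Gam_act C) (quotient_Gam_measure C).
Proof. exact: measure_preserving_quot_act. Qed.

Context dG (G : borelGroupType dG) (G_abelian : forall x y : G, x * y = y * x).
Context (sepG : countably_separated G) (pi : UMagmaMorphism.type Gam G).
Context (F : Sig * Sig -> G) (mF : measurable_fun [set: Sig * Sig] F).
Context (F_Lam : forall l x y, F (C (1, l) x, C (1, l) y) = F (x, y)).
Context (F_Gam : forall g1 g2, {ae (m \x m)%E, forall p,
  F (C (g1, 1) p.1, C (g2, 1) p.2) = pi g1 * F p * (pi g2)^-1}).
Context (mixing : weakly_mixing (quotient_Gam_act C) (quotient_Gam_measure C)).

Lemma cocycle_constant : exists c : G,
  {ae (m \x sigma_finite_product m m)%E, forall p,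
    F (p.1, p.2.1) * F (p.2.1, p.2.2) * (F (p.1, p.2.2))^-1 = c}.
Proof.
set m2 := sigma_finite_product m m.
pose fhat p := F (p.1, p.2.1) * F (p.2.1, p.2.2) * (F (p.1, p.2.2))^-1.
pose s := orbit_section (a := act_left C) (coupling_Y C).
have ms : measurable_fun setT s.
  exact: (measurable_orbit_section Gam_countable (coupling_Y_measurable C)).
pose Q := quotient_Gam C; pose mu := quotient_Gam_measure C.
pose q := orbit_class (act_left C); pose b := quotient_Gam_act C.
pose q3 (p : Sig * (Sig * Sig)) : Q * (Q * Q) := (q p.1, (q p.2.1, q p.2.2)).
pose f (p : Q * (Q * Q)) := fhat (s p.1, (s p.2.1, s p.2.2)).
have mfst : measurable_fun setT (fun p : Q * (Q * Q) => s p.1).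
  exact: measurableT_comp ms measurable_fst.
have mfst2 : measurable_fun setT (fun p : Q * (Q * Q) => s p.2.1).
  apply: measurableT_comp ms _.
  exact: measurableT_comp measurable_fst measurable_snd.
have msnd2 : measurable_fun setT (fun p : Q * (Q * Q) => s p.2.2).
  apply: measurableT_comp ms _.
  exact: measurableT_comp measurable_snd measurable_snd.
have mf : measurable_fun setT f.
  apply: measurable_fun_mulg; first apply: measurable_fun_mulg.
  - exact: measurableT_comp mF (measurable_fun_pair mfst mfst2).
  - exact: measurableT_comp mF (measurable_fun_pair mfst2 msnd2).
  - apply: measurable_fun_invg.
    exact: measurableT_comp mF (measurable_fun_pair mfst msnd2).
have nq3 : null_equivalence (m \x m2)%E (mu \x finite_product mu mu)%E q3.
  apply: (null_equivalence_prod (f := q) (g := fun p => (q p.1, q p.2))).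
    exact: null_equivalence_quotient_Gam.
  by apply: null_equivalence_prod; exact: null_equivalence_quotient_Gam.
(* Lifting back through [s] moves each coordinate by an element of [Gam], which leaves the cocycle
   unchanged. *)
have fq3 : {ae (m \x m2)%E, forall p, f (q3 p) = fhat p}.
  have FG : {ae (m \x m)%E, forall p, forall g1 g2,
      F (C (g1, 1) p.1, C (g2, 1) p.2) = pi g1 * F p * (pi g2)^-1}.
    apply: (ae_forall_countable (1 : Gam) Gam_countable) => g1.
    by apply: (ae_forall_countable (1 : Gam) Gam_countable) => g2.
  have G12 : {ae (m \x m2)%E, forall p, forall g1 g2,
      F (C (g1, 1) p.1, C (g2, 1) p.2.1) =
      pi g1 * F (p.1, p.2.1) * (pi g2)^-1}.
    by apply: (ae_prod_map measurable_fst _ FG) => P; exact: ae_fst.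
  have G13 : {ae (m \x m2)%E, forall p, forall g1 g2,
      F (C (g1, 1) p.1, C (g2, 1) p.2.2) =
      pi g1 * F (p.1, p.2.2) * (pi g2)^-1}.
    by apply: (ae_prod_map measurable_snd _ FG) => P; exact: ae_snd.
  have G23 := ae_snd m (m2 := m2) FG.
  have U1 := ae_fst m2 Y_unique_return.
  have U2 := ae_snd m (m2 := m2) (ae_fst m Y_unique_return).
  have U3 := ae_snd m (m2 := m2) (ae_snd m Y_unique_return).
  apply: filterS2 (filterI G12 (filterI G13 G23)) (filterI U1 (filterI U2 U3)).
  move=> [x [y z]] /= [E12 [E13 E23]] [[gx Ux] [[gy Uy] [gz Uz]]].
  rewrite /f /fhat /q3 /s /q /= (orbit_sectionE Ux) (orbit_sectionE Uy).
  rewrite (orbit_sectionE Uz) /= E12 E13 E23.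
  exact: mulg_translate_cocycle.
have q3_Lam l p : act_joint b (act_joint b b) l (q3 p) =
    q3 (act_joint (act_right C) (act_joint (act_right C) (act_right C)) l p).
  have bq x : b l (q x) = q (C (1, l) x).
    exact: (quot_act_class (act_left_right C)).
  by case: p => x [y z]; congr (_, (_, _)); exact: bq.
(* Invariance is checked upstairs, where [F_Lam] is exact, and descends because the set where it
   holds is measurable. *)
have f_Lam l : {ae (mu \x finite_product mu mu)%E, forall p,
    f (act_joint b (act_joint b b) l p) = f p}.
  apply: (ae_image nq3).
    apply: measurable_eq_fun => //.
    by apply: measurableT_comp mf _; exact: measurable_act.
  have nl : null_equivalence (m \x m2)%E (m \x m2)%E
      (act_joint (act_right C) (act_joint (act_right C) (act_right C)) l).
    apply: null_equivalence_act; apply: measure_preserving_joint => //.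
    exact: measure_preserving_joint.
  apply: filterS2 fq3 (ae_preimage nl fq3) => p fp flp.
  rewrite q3_Lam flp fp /fhat /=.
  by rewrite !F_Lam.
(* [mixing] serves twice: as weak mixing of the first factor and, unfolded, as ergodicity of the
   remaining square. *)
have erg : ergodic (act_joint b (act_joint b b)) (mu \x finite_product mu mu)%E.
  apply: ergodic_joint => //; try exact: measure_preserving_quotient_Gam.
  apply: (measure_preserving_joint (mu := mu) (zeta := mu));
  exact: measure_preserving_quotient_Gam.
have [c fc] := ergodic_ae_constant Lam_countable erg sepG mf f_Lam.
exists c; apply: filterS2 fq3 (ae_preimage nq3 fc) => p fp <-.
by rewrite fp.
Qed.

End coupling.

Theorem theorem4p3 (R : realType)
    (Gam : groupType) (Gam_countable : countable [set: Gam])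
    (dG : measure_display) (G : borelGroupType dG)
    (G_standard : standard_borel R G)
    (G_abelian : forall x y : G, x * y = y * x)
    (pi : UMagmaMorphism.type Gam G)
    (Lam : groupType) (Lam_countable : countable [set: Lam])
    (d : measure_display) (Sig : measurableType d)
    (m : {sigma_finite_measure set Sig -> \bar R})
    (C : coupling Gam Lam m)
    (mixing : weakly_mixing (quotient_Gam_act C) (quotient_Gam_measure C))
    (equivariant_square : exists Psi : fibre_square C -> G,
      measurable_fun [set: fibre_square C] Psi /\
      almost_equivariant (fibre_square_measure C)
        (fibre_square_act C) (translation_act pi pi) Psi) :
  exists (rho : UMagmaMorphism.type Lam G) (Phi : Sig -> G),
    measurable_fun [set: Sig] Phi /\
    almost_equivariant m C (translation_act pi rho) Phi.
Proof.
have [Psi [mPsi Psi_equiv]] := equivariant_square.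
(* Composing with the orbit map makes the invariance under [Lam] hold everywhere, while that under
   [Gam] stays almost everywhere. *)
pose F := Psi \o orbit_class (act_diag (act_right C)).
have mF : measurable_fun [set: Sig * Sig] F.
  exact: measurableT_comp mPsi (@measurable_orbit_class _ _ _ _).
have F_Lam l x y : F (C (1, l) x, C (1, l) y) = F (x, y).
  by rewrite /F/= -(orbit_class_act (act_diag (act_right C)) l (x, y)).
have F_Gam g1 g2 : {ae (m \x m)%E, forall p,
    F (C (g1, 1) p.1, C (g2, 1) p.2) = pi g1 * F p * (pi g2)^-1}.
  have := ae_preimage (null_equivalence_fibre_square Lam_countable C)
    (Psi_equiv (g1, g2)).
  apply: filterS => p E; apply: etrans E; congr Psi.
  exact/esym/(quot_act_class (@fibre_square_commute _ _ _ _ _ _ C)).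
have sepG := countably_separated_standard_borel G_standard.
have [c F_cocycle] := cocycle_constant Gam_countable Lam_countable G_abelian
  sepG mF F_Lam F_Gam mixing.
exact: (almost_equivariant_of_cocycle Gam_countable G_abelian
  (coupling_preserving C) mF F_Lam F_Gam F_cocycle).
Qed.
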